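(* Let $N\ge 1$, let $\mathcal{G}$ be a closed (hence compact) subgroup of the unitary group $U(N)$, let $(e_1,\dots,e_N)$ be an orthonormal basis of $\mathbb{C}^N$, and let $\mathcal{H}:=\{H\in\mathcal{G}\mid H(e_1)=e_1\}$. Let $\mu_{\mathcal{G}}$ and $\mu_{\mathcal{H}}$ be the Haar probability measures on $\mathcal{G}$ and $\mathcal{H}$, and let $f:\mathcal{G}\to\mathbb{C}^N$ be the map $f(G)=G(e_1)$. Let $M$ and $H$ be independent random matrices, with $M$ taking values in $\mathcal{G}$ and $H$ taking values in $\mathcal{H}$ with distribution $\mu_{\mathcal{H}}$. Then the product $MH$ has distribution $\mu_{\mathcal{G}}$ if and only if the random vector $M(e_1)$ has distribution $f(\mu_{\mathcal{G}})$.
   Context: $f(\mu_{\mathcal{G}})$ denotes the image (pushforward) measure of $\mu_{\mathcal{G}}$ under $f$, i.e. the law of $G(e_1)$ when $G$ has distribution $\mu_{\mathcal{G}}$. The Haar probability measure of a compact group is its unique translation-invariant Borel probability measure. *)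

(* Defs.v *)
From HB Require Import structures.
From mathcomp Require Import all_boot all_order all_algebra spectral.
From mathcomp Require Import complex.
From mathcomp Require Import all_classical all_reals all_analysis.
Import Order.TTheory GRing.Theory Num.Theory.
Import numFieldNormedType.Exports.

Set Implicit Arguments.
Unset Strict Implicit.
Unset Printing Implicit Defensive.

Local Open Scope classical_set_scope.
Local Open Scope sesquilinear_scope.
Local Open Scope ring_scope.

(* R[i] is packed as a [numClosedFieldType] because the topology of scalars and
   of matrices is found from that structure, not from the bare type [R[i]]. *)
Definition cplx (R : realType) : numClosedFieldType := R[i]%C.

Definition borel (T : ptopologicalType) := g_sigma_algebraType (@open T).

(* U(N) is closed in the space of N x N matrices, so a subset of U(N) is closed
   in U(N) exactly when it is closed in that space. *)
Definition closed_unitary_subgroup (C : numClosedFieldType) (N : nat)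
    (G : set 'M[C]_N) : Prop :=
  [/\ forall g, G g -> g \is unitarymx,
      G 1%:M,
      forall g h, G g -> G h -> G (g *m h),
      forall g, G g -> G (invmx g)
    & closed G].

Definition orthonormal_basis (C : numClosedFieldType) (N : nat)
    (e : 'I_N -> 'cV[C]_N) : Prop :=
  basis_of fullv (codom e) /\
  forall i j, ((e i)^t* *m e j) 0 0 = (i == j)%:R.

Definition stabilizer (C : numClosedFieldType) (N : nat)
    (G : set 'M[C]_N) (v : 'cV[C]_N) : set 'M[C]_N :=
  [set g | G g /\ g *m v = v].

(* A Borel probability measure on the closed set [G] is represented by a Borel
   probability measure on the whole matrix space that gives mass 1 to [G]. *)
Definition haar_probability (R : realType) (N : nat) (G : set 'M[cplx R]_N)
    (mu : probability (borel 'M[cplx R]_N) R) : Prop :=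
  mu G = 1%E /\
  forall (g : 'M[cplx R]_N) (A : set (borel 'M[cplx R]_N)),
    G g -> measurable A -> A `<=` G ->
    mu [set g *m x | x in A] = mu A /\ mu [set x *m g | x in A] = mu A.

Definition has_law d d' (T : measurableType d) (T' : measurableType d')
    (R : realType) (P : probability T R) (X : T -> T')
    (nu : set T' -> \bar R) : Prop :=
  measurable_fun setT X /\
  forall A, measurable A -> P (X @^-1` A) = nu A.

Definition independent_rv d d1 d2 (T : measurableType d)
    (T1 : measurableType d1) (T2 : measurableType d2)
    (R : realType) (P : probability T R) (X : T -> T1) (Y : T -> T2) : Prop :=
  forall A B, measurable A -> measurable B ->
    P (X @^-1` A `&` Y @^-1` B) = (P (X @^-1` A) * P (Y @^-1` B))%E.

(* Main.v *)
Require Import Defs.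
From HB Require Import structures.
From mathcomp Require Import all_boot all_order all_algebra spectral.
From mathcomp Require Import complex.
From mathcomp Require Import all_classical all_reals all_analysis.
From mathcomp Require Import measurable_realfun.
Import Order.TTheory GRing.Theory Num.Theory.
Import numFieldNormedType.Exports.

Set Implicit Arguments.
Unset Strict Implicit.
Unset Printing Implicit Defensive.

Local Open Scope classical_set_scope.
Local Open Scope ring_scope.

(** The law of [M] and the Haar measure of [G] agree on Borel sets that are unions
of fibres of [f : g |-> g e1], i.e. of left cosets of the stabilizer [Hs], because
both project to the same law under [f].  For closed [C] put
[phi m = muH {h | m h \in C}].  Invariance of [muH] makes [phi] constant on these
fibres, and [phi] is upper semicontinuous on [G], so its superlevel sets in [G] are
compact unions of fibres; each is the preimage of its compact, hence Borel, image.
Thus [phi] has the same law, and the same integral, under [M] as under [muG].  By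
independence the first integral is [P (M H \in C)]; by Fubini and right invariance
of [muG] the second is [muG C].  Closed sets determine Borel probability measures. *)

(** * Continuity of matrix multiplication in the entrywise topology *)

Lemma cvg_mx_entries (T : topologicalType) (I : Type) (F : set_system I)
    (m n : nat) (f : I -> 'M[T]_(m, n)) (A : 'M[T]_(m, n)) :
  Filter F ->
  (forall i j, (fun x => f x i j) @ F --> A i j) -> f @ F --> A.
Proof.
move=> FF fA B [P AP PB].
have : \forall x \near F, forall ij, P ij.1 ij.2 (f x ij.1 ij.2).
  by apply: filter_forall => -[i j]; exact: fA (AP i j).
by apply: filterS => x Px; apply: PB => i j; exact: (Px (i, j)).
Qed.

Lemma mulmx_continuous (K : numFieldType) (m n p : nat) :
  continuous (fun X : 'M[K]_(m, n) * 'M[K]_(n, p) => X.1 *m X.2).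
Proof.
move=> X; apply: cvg_mx_entries => i j; rewrite mxE.
under eq_fun do rewrite mxE.
apply: cvg_big => [|k _]; first exact: add_continuous.
apply: cvgM.
  apply: (@cvg_comp _ _ _ fst (fun A : 'M[K]_(m, n) => A i k)).
    exact: cvg_fst.
  exact: coord_continuous.
apply: (@cvg_comp _ _ _ snd (fun A : 'M[K]_(n, p) => A k j)).
  exact: cvg_snd.
exact: coord_continuous.
Qed.

Lemma mulmxl_continuous (K : numFieldType) (m n p : nat) (A : 'M[K]_(m, n)) :
  continuous (fun X : 'M[K]_(n, p) => A *m X).
Proof.
move=> X; apply: (@cvg_comp _ _ _ (pair A) (fun Y => Y.1 *m Y.2) _
  (filter_prod (nbhs A) (nbhs X))).
  move=> P [[V W] /= [AV XW] VWP]; apply: filterS XW => Y YW.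
  by apply: VWP; split=> //=; exact: nbhs_singleton.
exact: (@mulmx_continuous K m n p (A, X)).
Qed.

Lemma mulmxr_continuous (K : numFieldType) (m n p : nat) (A : 'M[K]_(n, p)) :
  continuous (fun X : 'M[K]_(m, n) => X *m A).
Proof.
move=> X; apply: (@cvg_comp _ _ _ (pair^~ A) (fun Y => Y.1 *m Y.2) _
  (filter_prod (nbhs X) (nbhs A))).
  move=> P [[V W] /= [XV AW] VWP]; apply: filterS XV => Y YV.
  by apply: VWP; split=> //=; exact: nbhs_singleton.
exact: (@mulmx_continuous K m n p (X, A)).
Qed.

(** * Complex scalars through real coordinates, and countable bases *)

Lemma cplx_pair_dist (R : realType) (a b c d : R) :
  (`|(a +i* b)%C - (c +i* d)%C : cplx R| <= (`|a - c| + `|b - d|)%:C%C).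
Proof.
rewrite [X in `|X|](_ : _ = (a - c)%:C%C + 'i%C * (b - d)%:C%C); last first.
  by rewrite [LHS]complexE.
apply: le_trans (ler_normD _ _) _.
have normC (x : R) : `|x%:C%C : cplx R| = `|x|%:C%C.
  by rewrite normc_def /= expr0n addr0 sqrtr_sqr.
have normi : `|'i%C : cplx R| = 1.
  by rewrite normc_def /= expr0n add0r expr1n sqrtr1.
by rewrite normrM normi mul1r !normC rmorphD.
Qed.

(** Radii of balls in [cplx R] are themselves complex. The order compares only numbers with equal
    imaginary parts, so a positive radius is real and real estimates suffice. *)
Lemma cplx_pos (R : realType) (e : cplx R) :
  0 < e -> exists2 r : R, 0 < r & e = r%:C%C.
Proof.
case: e => a b; rewrite ltcE /= => /andP[/eqP b0 a0].
by exists a => //; rewrite b0.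
Qed.

Lemma cplx_pair_continuous (R : realType) :
  continuous (fun x : R * R => (x.1 +i* x.2)%C : cplx R).
Proof.
move=> [a b]; apply/cvgrPdist_lt => /= e e0.
have [r r0 ->] := cplx_pos e0.
have r2 : 0 < r / 2 by rewrite divr_gt0.
apply: filterS (nbhsx_ballx (a, b) _ r2) => -[c d] [/= ac bd].
apply: le_lt_trans (cplx_pair_dist _ _ _ _) _.
by rewrite ltcR (splitr r) ltrD.
Qed.

(** Second countability, enumerated by [nat] so that an open set of a product becomes a countable
    union of rectangles. *)
Definition base_sequence (T : topologicalType) (f : nat -> set T) :=
  (forall n, open (f n)) /\
  forall x U, nbhs x U -> exists n, f n x /\ f n `<=` U.

Lemma cplx_base_sequence (R : realType) :
  exists f : nat -> set (cplx R), base_sequence f.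
Proof.
(* Numbers that code no triple are sent to [set0], which is open and harmless in a base. *)
exists (fun n => if unpickle n is Some (p, q, k) then
   ball ((ratr p +i* ratr q)%C : cplx R) (k.+1%:R^-1) else set0).
split=> [n|z U].
  case: unpickle => [[[p q] k]|]; last exact: open0.
  exact: ball_open.
move=> /nbhs_ballP[e /= /cplx_pos[r r0 ->] eU].
(* A base ball of radius below [r / 2] that contains [z] lies in the ball of radius [r] about [z].
   Approximating each coordinate within half of the base radius keeps [z] inside. *)
have [k kr] : exists k, (k.+1%:R^-1 < r / 2 :> R).
  by have [k] := ltr_add_invr (divr_gt0 r0 (ltr0n _ 2)); rewrite add0r; exists k.
case: z eU => a b eU.
have approx (x : R) : exists q : rat, `|ratr q - x| < k.+1%:R^-1 / 2.
  have k2 : 0 < k.+1%:R^-1 / 2 :> R by rewrite divr_gt0 ?invr_gt0.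
  have /rat_in_itvoo[q] : x < x + k.+1%:R^-1 / 2 by rewrite ltrDl.
  rewrite in_itv /= => /andP[xq qx]; exists q.
  by rewrite gtr0_norm ?subr_gt0// ltrBlDl.
have [p ap] := approx a; have [q bq] := approx b.
have pqab : ball ((ratr p +i* ratr q)%C : cplx R) (k.+1%:R^-1) (a +i* b)%C.
  rewrite -ball_normE /=.
  apply: le_lt_trans (cplx_pair_dist _ _ _ _) _.
  have -> : (k.+1%:R^-1 : cplx R) = (k.+1%:R^-1 : R)%:C%C.
    by rewrite fmorphV rmorph_nat.
  by rewrite ltcR (splitr k.+1%:R^-1) ltrD.
exists (pickle (p, q, k)); rewrite pickleK; split=> // w pqw.
apply: eU; apply: (@le_ball _ _ _ (k.+1%:R^-1 + k.+1%:R^-1)).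
  have -> : (k.+1%:R^-1 : cplx R) = (k.+1%:R^-1 : R)%:C%C.
    by rewrite fmorphV rmorph_nat.
  by rewrite -rmorphD lecR (splitr r) lerD// ltW.
by apply: ball_triangle pqw; exact: ball_sym.
Qed.

(** Finite functions from positions to [nat] form a countable type, so boxes of base sets can be
    enumerated. *)
Lemma mx_base_sequence (T : topologicalType) (m n : nat) (f : nat -> set T) :
  base_sequence f -> exists g : nat -> set 'M[T]_(m, n), base_sequence g.
Proof.
move=> [fo fb].
exists (fun k => if @unpickle {ffun 'I_m * 'I_n -> nat} k is Some u then
  [set A | forall i j, f (u (i, j)) (A i j)] else set0).
split=> [k|A U [P AP PU]].
  case: unpickle => [u|]; last exact: open0.
  rewrite openE => A Au; exists (fun i j => f (u (i, j))) => // i j.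
  by apply: open_nbhs_nbhs; split.
have /choice[u uP] : forall ij : 'I_m * 'I_n, exists k,
    f k (A ij.1 ij.2) /\ f k `<=` P ij.1 ij.2.
  by move=> ij; exact: fb (AP _ _).
exists (pickle [ffun ij => u ij]); rewrite pickleK; split=> [i j|B Bu].
  by rewrite ffunE; have [] := uP (i, j).
apply: PU => i j; have [_] := uP (i, j); apply.
by have := Bu i j; rewrite ffunE.
Qed.

Lemma open_prod_measurable (T1 T2 : ptopologicalType) (f1 : nat -> set T1)
    (f2 : nat -> set T2) (U : set (T1 * T2)) :
  base_sequence f1 -> base_sequence f2 -> open U ->
  measurable (U : set (borel T1 * borel T2)).
Proof.
move=> [f1o f1b] [f2o f2b] Uo.
(* The inclusion in [U] sits inside the set, so the union runs over all [k] and [l] and a rectangle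
   that leaves [U] contributes nothing. *)
rewrite (_ : U = \bigcup_k \bigcup_l
  [set x | [/\ f1 k x.1, f2 l x.2 & f1 k `*` f2 l `<=` U]]); last first.
  apply/seteqP; split=> [x|x [k _] [l _] /= [? ?]]; last by apply; split.
  move: Uo; rewrite openE => /[apply] -[[V W] /= [xV xW] VW].
  have [k [kx kV]] := f1b _ _ xV; have [l [lx lW]] := f2b _ _ xW.
  exists k => //; exists l => //; split=> // y [y1 y2].
  by apply: VW; split; [exact: kV|exact: lW].
apply: bigcupT_measurable => k; apply: bigcupT_measurable => l.
have [klU|klU] := pselect (f1 k `*` f2 l `<=` U).
  rewrite [X in measurable X](_ : _ =
      (f1 k : set (borel T1)) `*` (f2 l : set (borel T2))).
    by apply: measurableX; exact: sub_sigma_algebra.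
  by apply/seteqP; split=> x /= [].
rewrite [X in measurable X](_ : _ = set0); first exact: measurable0.
by apply/seteqP; split=> x //= [].
Qed.

(** * Compactness of closed sets of unitary matrices *)

Lemma mx_entry_cvg (T : topologicalType) (m n : nat) (i : 'I_m) (j : 'I_n) :
  continuous (fun A : 'M[T]_(m, n) => A i j).
Proof.
move=> A U AU; exists (fun i' j' => if (i', j') == (i, j) then U else setT).
  by move=> i' j'; case: eqP => [[-> ->]|_] //; exact: filterT.
by move=> B /(_ i j); rewrite eqxx.
Qed.

Lemma mx_compact (T : ptopologicalType) (m n : nat) (A : set T) :
  compact A -> compact [set M : 'M[T]_(m, n) | forall i j, A (M i j)].
Proof.
move=> cA.
(* Flattening to row vectors brings in [rV_compact], a finite Tychonoff theorem; the continuous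
   [vec_mx] carries compactness back. *)
rewrite (_ : [set M | _] =
  vec_mx @` [set v : 'rV[T]_(m * n) | forall k, A (v ord0 k)]); last first.
  apply/seteqP; split=> [M AM|_ [v Av <-] i j]; last by rewrite mxE.
  exists (mxvec M); last exact: mxvecK.
  by move=> k; case/mxvec_indexP: k => i j; rewrite mxvecE.
apply: continuous_compact; last exact: (@rV_compact T _ (fun=> A)).
apply: continuous_subspaceT => v.
apply: (@cvg_mx_entries T _ (nbhs v) m n vec_mx (vec_mx v)) => i j.
rewrite mxE; under eq_fun do rewrite mxE.
exact: mx_entry_cvg.
Qed.

Lemma cplx_square_compact (R : realType) :
  compact [set z : cplx R | `|complex.Re z| <= 1 /\ `|complex.Im z| <= 1].
Proof.
rewrite (_ : [set z | _] = (fun x : R * R => (x.1 +i* x.2)%C : cplx R) @`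
   (`[-1, 1]%classic `*` `[-1, 1]%classic)); last first.
  apply/seteqP; split=> [[a b] /= []|_ [[a b] /= [+ +] <-]].
    by rewrite !ler_norml => a1 b1; exists (a, b); rewrite //= !in_itv.
  by rewrite !in_itv /= !ler_norml.
apply: continuous_compact.
  exact: continuous_subspaceT (@cplx_pair_continuous R).
by apply: compact_setX; exact: segment_compact.
Qed.

(** The squared moduli in row [i] add up to the diagonal entry at [i] of [A] times its adjoint,
    which is 1. *)
Lemma unitarymx_entry_le1 (C : numClosedFieldType) (n : nat) (A : 'M[C]_n)
  (i j : 'I_n) : A \is unitarymx -> `|A i j| <= 1.
Proof.
move=> /unitarymxP /matrixP /(_ i i); rewrite !mxE eqxx => AA.
rewrite -(@ler_pXn2r _ 2)// ?nnegrE// expr1n -[leRHS]AA (bigD1 j)//= !mxE.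
rewrite -normCK lerDl sumr_ge0// => k _.
by rewrite !mxE -normCK exprn_ge0.
Qed.

Lemma unitary_closed_compact (R : realType) (n : nat) (G : set 'M[cplx R]_n) :
  (forall g, G g -> g \is unitarymx) -> closed G -> compact G.
Proof.
move=> Gu Gc.
apply: subclosed_compact Gc (mx_compact (@cplx_square_compact R)) _ => g Gg i j.
have := unitarymx_entry_le1 i j (Gu _ Gg).
case: (g i j) => a b; rewrite normc_def lecR => /=.
rewrite -[X in _ <= X]sqrtr1 ler_sqrt// => ab.
split; rewrite -(@ler_pXn2r _ 2)// ?nnegrE// expr1n real_normK ?num_real//.
  by apply: le_trans ab; rewrite lerDl sqr_ge0.
by apply: le_trans ab; rewrite lerDr sqr_ge0.
Qed.

(** * Borel sets, laws and integrals *)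

Lemma open_borel (T : ptopologicalType) (U : set T) :
  open U -> measurable (U : set (borel T)).
Proof. exact: sub_sigma_algebra. Qed.

Lemma closed_borel (T : ptopologicalType) (C : set T) :
  closed C -> measurable (C : set (borel T)).
Proof.
move=> Cc; rewrite -[C]setCK.
by apply: (@measurableC _ (borel T)); apply: open_borel; exact: closed_openC.
Qed.

Lemma open_preimage_measurable d (T : measurableType d) (U : ptopologicalType)
    (f : T -> borel U) :
  (forall V : set U, open V -> measurable (f @^-1` V)) -> measurable_fun setT f.
Proof.
move=> fo; apply: (measurability _ (erefl (measurable : set (set (borel U))))).
by move=> _ [V oV <-]; rewrite setTI; exact: fo.
Qed.

Lemma continuous_borel (T U : ptopologicalType) (f : T -> U) :
  continuous f -> measurable_fun setT (f : borel T -> borel U).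
Proof.
move=> /continuousP fc; apply: open_preimage_measurable => V oV.
by apply: open_borel; exact: fc.
Qed.

Lemma continuous_borel_preimage (T U : ptopologicalType) (f : T -> U)
    (A : set U) : continuous f -> measurable (A : set (borel U)) ->
  measurable (f @^-1` A : set (borel T)).
Proof.
by move=> /continuous_borel mf mA; rewrite -[X in measurable X]setTI; exact: mf.
Qed.

Lemma probability_eq_on_closed (T : ptopologicalType) (R : realType)
    (m1 m2 : probability (borel T) R) :
  (forall C : set T, closed C -> m1 C = m2 C) ->
  forall A, measurable A -> m1 A = m2 A.
Proof.
move=> m12; apply: (@measure_unique _ R (borel T) (@closed T) (fun=> setT)) => //.
- apply/seteqP; split.
    apply: smallest_sub; first exact: smallest_sigma_algebra.
    move=> U oU; rewrite -[U]setCK -setTD.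
    apply: sigma_algebraCD; apply: sub_sigma_algebra; exact: open_closedC.
  apply: smallest_sub; first exact: smallest_sigma_algebra.
  by move=> C /closed_borel.
- by move=> A B; exact: closedI.
- by apply/seteqP; split=> // x _; exists 0%N.
- by move=> _; apply: le_lt_trans (probability_le1 m1 _) (ltry _).
Qed.

(** Continuity makes preimages of open sets open in the product space; the countable bases place
    them in the product sigma-algebra, where joint laws live. *)
Lemma mulmx_borel_measurable (R : realType) (m n p : nat) :
  measurable_fun setT (fun X : borel 'M[cplx R]_(m, n) * borel 'M[cplx R]_(n, p) =>
    X.1 *m X.2 : borel 'M[cplx R]_(m, p)).
Proof.
have [f fP] := cplx_base_sequence R.
have [f1 f1P] := mx_base_sequence m n fP.
have [f2 f2P] := mx_base_sequence n p fP.
apply: open_preimage_measurable => V oV.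
apply: (open_prod_measurable f1P f2P).
by move/continuousP: (@mulmx_continuous (cplx R) m n p); exact.
Qed.

Lemma probability_setC0 d (T : measurableType d) (R : realType)
    (P : probability T R) (D : set T) :
  measurable D -> P D = 1%E -> P (~` D) = 0%E.
Proof. by move=> mD PD; rewrite probability_setC// PD subee. Qed.

Lemma probability_setI1 d (T : measurableType d) (R : realType)
    (P : probability T R) (D A : set T) :
  measurable D -> measurable A -> P D = 1%E -> P (A `&` D) = P A.
Proof.
move=> mD mA PD.
have PDC := probability_setC0 mD PD.
have mDC : measurable (~` D) by exact: measurableC.
have PADC : P (A `&` ~` D) = 0%E.
  by apply: subset_measure0 PDC => //; exact: measurableI.
transitivity (P (A `&` D) + P (A `&` ~` D))%E; first by rewrite PADC adde0.
rewrite -[in RHS](setIT A) -(setUv D) setIUr; apply/esym/measureU.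
- exact: measurableI.
- exact: measurableI.
- by rewrite setIACA setICr setI0.
Qed.

(** The integral depends only on the law of [phi], and that law is determined on the closed upper
    rays, a generating pi-system of the extended reals. *)
Lemma ge0_integral_eq_superlevel d (T : measurableType d) (R : realType)
    (P Q : probability T R) (phi : T -> \bar R) :
  measurable_fun setT phi -> (forall x, 0 <= phi x)%E ->
  (forall t, P [set x | t <= phi x]%E = Q [set x | t <= phi x]%E) ->
  (\int[P]_x phi x = \int[Q]_x phi x)%E.
Proof.
move=> mphi phi0 PQ.
pose phiM : {mfun T >-> \bar R} := HB.pack phi (isMeasurableFun.Build _ _ _ _ _ mphi).
(* The change of variables is applied to an integrand that is nonnegative everywhere; [|y|] agrees
   with [y] on the values of [phi]. *)
have E (S : probability T R) :
    (\int[S]_x phi x = \int[distribution S phiM]_y `|y|)%E.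
  rewrite ge0_integral_distribution//.
  by apply: eq_integral => x _ /=; rewrite gee0_abs.
rewrite !E; apply: eq_measure_integral => A mA _.
pose rays := [set A : set (\bar R) | exists r, A = [set x | (r <= x)%E]].
apply: (@measure_unique _ R (\bar R) rays (fun=> setT)) => //.
- apply/seteqP; split.
    rewrite [X in X `<=` _]ErealGenCInfty.measurableE.
    apply: smallest_sub; first exact: smallest_sigma_algebra.
    move=> _ [r ->]; apply: sub_sigma_algebra; exists r%:E.
    by apply/seteqP; split=> x; rewrite /= in_itv /= andbT.
  apply: smallest_sub; first exact: sigma_algebra_measurable.
  move=> _ [r ->]; rewrite (_ : [set x | _] = `[r, +oo[%classic).
    exact: emeasurable_itv.
  by apply/seteqP; split=> x; rewrite /= in_itv /= andbT.
- move=> _ _ [r ->] [s ->]; exists (maxe r s).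
  by apply/seteqP; split=> x /=; rewrite ge_max => /andP.
(* The endpoint [-oo] makes the whole space a ray, which supplies the exhausting sequence. *)
- by move=> _; exists -oo%E; apply/seteqP; split=> x //= _; rewrite leNye.
- by apply/seteqP; split=> // x _; exists 0%N.
- by move=> _ [r ->]; exact: PQ.
- by move=> _; apply: le_lt_trans (probability_le1 (distribution P phiM) _) (ltry _).
Qed.

(** Independence makes the joint law agree with the product of the marginals on rectangles, hence
    everywhere; the product measure is by construction the integral of the sections. *)
Lemma independent_pair_law d d1 d2 (T : measurableType d)
    (T1 : measurableType d1) (T2 : measurableType d2) (R : realType)
    (P : probability T R) (X : {RV P >-> T1}) (Y : {RV P >-> T2})
    (A : set (T1 * T2)) :
  independent_rv P X Y -> measurable A ->
  P [set w | A (X w, Y w)] =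
  (\int[distribution P X]_x P (Y @^-1` xsection A x))%E.
Proof.
move=> indep mA.
have mXY : measurable_fun setT (fun w => (X w, Y w)).
  by apply/measurable_fun_pair.
pose XY : {mfun T >-> (T1 * T2)%type} :=
  HB.pack (fun w => (X w, Y w)) (isMeasurableFun.Build _ _ _ _ _ mXY).
rewrite -[LHS]/(distribution P XY A).
rewrite -(@product_measure_unique _ _ _ _ _ (distribution P X) (distribution P Y))//.
Qed.

(** * Upper semicontinuity of the mass of translated closed sets *)

Lemma mulmx_unitary_ball (C : numClosedFieldType) (n : nat)
    (A B U : 'M[C]_n) (e : C) : 0 < e -> U \is unitarymx ->
  ball A (e / n.+1%:R) B -> ball (A *m U) e (B *m U).
Proof.
move=> e0 Uu [_ AB]; split=> // i j.
rewrite -ball_normE /= !mxE -sumrB.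
apply: le_lt_trans (ler_norm_sum _ _ _) _.
(* The sum of [n] terms of size at most [e / (n + 1)] is strictly below [e]; the divisor is nonzero
   even for [n = 0]. *)
apply: (@le_lt_trans _ _ (\sum_(k < n) e / n.+1%:R)).
  apply: ler_sum => k _; rewrite -mulrBl normrM -[leRHS]mulr1.
  apply: ler_pM => //; last exact: unitarymx_entry_le1.
  by have := AB i k; rewrite -ball_normE /= => /ltW.
rewrite sumr_const card_ord -[ltLHS]mulr_natr -mulrA.
by rewrite gtr_pMr// mulrC ltr_pdivrMr ?ltr0n// mul1r ltr_nat.
Qed.

Lemma bigcap_thickening (R : realType) (T : pseudoMetricType (cplx R))
    (C : set T) : closed C ->
  \bigcap_k [set x | exists2 y, C y & ball y (k.+1%:R^-1) x] = C.
Proof.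
move=> Cc; apply/seteqP; split=> [x Cx|x Cx k _]; last first.
  by exists x => //; apply: ballxx; rewrite invr_gt0 ltr0n.
apply: Cc => U /nbhs_ballP[e /= /cplx_pos[r r0 ->] eU].
have [k] := ltr_add_invr r0; rewrite add0r => kr.
have [y Cy yx] := Cx k I; exists y; split=> //.
apply: eU; apply: ball_sym; apply: le_ball yx.
have -> : (k.+1%:R^-1 : cplx R) = (k.+1%:R^-1 : R)%:C%C.
  by rewrite fmorphV rmorph_nat.
by rewrite lecR ltW.
Qed.

(* Upper semicontinuity: a point [h] sent into [C] by a matrix close to [m0] is
   sent by [m0] itself into a thickening of [C], uniformly for [h] unitary. *)
Lemma closed_superlevel_section (R : realType) (n : nat) (G D : set 'M[cplx R]_n)
    (mu : probability (borel 'M[cplx R]_n) R) (C : set 'M[cplx R]_n)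
    (t : \bar R) :
  closed G -> closed D -> (forall g, D g -> g \is unitarymx) ->
  mu D = 1%E -> closed C ->
  closed [set m | G m /\ (t <= mu [set h | C (m *m h)])%E].
Proof.
move=> Gc Dc Du muD Cc m0 clm0; split.
  by apply: Gc; apply: closure_subset clm0 => m [].
pose Ck k : set 'M[cplx R]_n := [set x | exists2 y, C y & ball y (k.+1%:R^-1) x].
have Ck_open k : open (Ck k).
  rewrite (_ : Ck k = \bigcup_(y in C) ball y (k.+1%:R^-1)).
    by apply: bigcup_open => y _; exact: ball_open.
  by apply/seteqP; split=> x [y ? ?]; exists y.
have mul_meas (A : set 'M[cplx R]_n) (m : 'M[cplx R]_n) :
    measurable (A : set (borel _)) ->
    measurable ([set h | A (m *m h)] : set (borel _)).
  exact: continuous_borel_preimage (@mulmxl_continuous _ _ _ _ m).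
pose F k : set (borel 'M[cplx R]_n) := [set h | Ck k (m0 *m h)].
have mF k : measurable (F k) by apply: mul_meas; exact: open_borel.
have bigF : \bigcap_k F k = [set h | C (m0 *m h)].
  by rewrite -[in RHS](bigcap_thickening Cc).
have mC (m : 'M[cplx R]_n) : measurable ([set h | C (m *m h)] : set (borel _)).
  by apply: mul_meas; exact: closed_borel.
have Fcvg : mu \o F @ \oo --> mu (\bigcap_k F k).
  apply: nonincreasing_cvg_mu => //.
  - by apply: le_lt_trans (probability_le1 mu _) (ltry _).
  - by rewrite bigF; exact: mC.
  - move=> k l kl; apply/subsetPset => h [y Cy yh]; exists y => //.
    by apply: le_ball yh; rewrite lef_pV2 ?posrE ?ltr0n// ler_nat.
(* By continuity from above it suffices that [t] bounds every [mu (F k)] from below. *)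
rewrite -bigF; apply: (cvge_to_ge Fcvg); apply: nearW => k /=.
have k0 : 0 < k.+1%:R^-1 / n.+1%:R :> cplx R by rewrite divr_gt0 ?invr_gt0 ?ltr0n.
have [m [[Gm tm] m0m]] := clm0 _ (nbhsx_ballx m0 _ k0).
apply: le_trans tm _.
(* [D] has full mass, so only unitary [h] matter. *)
rewrite -(probability_setI1 (closed_borel Dc) (mC m) muD).
apply: le_measure; rewrite ?inE.
- by apply: measurableI => //; exact: closed_borel.
- exact: mF.
move=> h [/= Cmh Dh]; exists (m *m h) => //.
by apply: ball_sym; apply: mulmx_unitary_ball m0m; rewrite ?invr_gt0 ?ltr0n//; exact: Du.
Qed.

(** * Haar measures: invariance, averaging and cosets *)

Lemma stabilizer_closed_unitary_subgroup (C : numClosedFieldType) (n : nat)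
    (G : set 'M[C]_n) (v : 'cV[C]_n) :
  closed_unitary_subgroup G -> closed_unitary_subgroup (stabilizer G v).
Proof.
move=> [Gu G1 GM GV Gc]; split.
- by move=> g [/Gu].
- by split=> //; rewrite mul1mx.
- by move=> g h [Gg gv] [Gh hv]; split; [exact: GM|rewrite -mulmxA hv].
- move=> g [Gg gv]; split; first exact: GV.
  by rewrite -{1}gv mulKmx// unitarymx_unit// Gu.
- rewrite (_ : stabilizer G v = G `&` (fun g => g *m v) @^-1` [set v]) //.
  apply: closedI => //; apply: closed_comp => [x _|].
    exact: mulmxr_continuous.
  apply: accessible_closed_set1; apply: hausdorff_accessible.
  exact: norm_hausdorff.
Qed.

(** Invariance is given for images of Borel subsets of [G]. Cutting with [G] loses no mass, and
    since [G] contains the inverse of [g], translation carries the cut preimage of [A] onto the part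
    of [A] in [G]. *)
Lemma haar_preimage_mul (R : realType) (n : nat) (G : set 'M[cplx R]_n)
    (mu : probability (borel 'M[cplx R]_n) R) (g : 'M[cplx R]_n)
    (A : set 'M[cplx R]_n) :
  closed_unitary_subgroup G -> haar_probability G mu -> G g ->
  measurable (A : set (borel _)) ->
  mu [set x | A (g *m x)] = mu A /\ mu [set x | A (x *m g)] = mu A.
Proof.
move=> [Gu G1 GM GV Gc] [muG inv] Gg mA.
have mG := closed_borel Gc.
have gU : g \in unitmx by apply: unitarymx_unit; exact: Gu.
have mlA : measurable ([set x | A (g *m x)] : set (borel _)).
  exact: continuous_borel_preimage (@mulmxl_continuous _ _ _ _ g) mA.
have mrA : measurable ([set x | A (x *m g)] : set (borel _)).
  exact: continuous_borel_preimage (@mulmxr_continuous _ _ _ _ g) mA.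
rewrite -(probability_setI1 mG mlA muG) -(probability_setI1 mG mrA muG).
rewrite -(probability_setI1 mG mA muG); split.
  have [<- _] := inv g _ Gg (measurableI _ _ mlA mG) (@subIsetr _ _ _).
  congr (mu _); apply/seteqP; split=> [_ [x [/= Ax Gx] <-]|x [Ax Gx]].
    by split=> //; exact: GM.
  exists (invmx g *m x); last exact: mulKVmx.
  by split; rewrite /= ?mulKVmx//; apply: GM => //; exact: GV.
have [_ <-] := inv g _ Gg (measurableI _ _ mrA mG) (@subIsetr _ _ _).
congr (mu _); apply/seteqP; split=> [_ [x [/= Ax Gx] <-]|x [Ax Gx]].
  by split=> //; exact: GM.
exists (x *m invmx g); last exact: mulmxKV.
by split; rewrite /= ?mulmxKV//; apply: GM => //; exact: GV.
Qed.

Lemma mulmx_preimage_measurable (R : realType) (n : nat)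
    (A : set (borel 'M[cplx R]_n)) : measurable A ->
  measurable ([set x | A (x.1 *m x.2)] :
    set (borel 'M[cplx R]_n * borel 'M[cplx R]_n)).
Proof.
by move=> mA; rewrite -[X in measurable X]setTI;
   exact: (mulmx_borel_measurable measurableT mA).
Qed.

Lemma xsection_mulmx (K : numFieldType) (n : nat) (A : set 'M[K]_n) (m : 'M[K]_n) :
  xsection [set x | A (x.1 *m x.2)] m = [set h | A (m *m h)].
Proof. by apply/seteqP; split=> h => [/xsectionP|?] //; exact/xsectionP. Qed.

Lemma ysection_mulmx (K : numFieldType) (n : nat) (A : set 'M[K]_n) (h : 'M[K]_n) :
  ysection [set x | A (x.1 *m x.2)] h = [set m | A (m *m h)].
Proof. by apply/seteqP; split=> m => [/ysectionP|?] //; exact/ysectionP. Qed.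

Lemma mul_section_measurable (R : realType) (n : nat)
    (mu : probability (borel 'M[cplx R]_n) R) (A : set (borel 'M[cplx R]_n)) :
  measurable A ->
  measurable_fun setT (fun m : borel 'M[cplx R]_n => mu [set h | A (m *m h)]).
Proof.
move=> mA.
rewrite (_ : (fun m => _) =
    mu \o xsection [set x : 'M[cplx R]_n * 'M[cplx R]_n | A (x.1 *m x.2)]).
  by apply: measurable_fun_xsection; exact: mulmx_preimage_measurable.
by apply/funext => m /=; rewrite xsection_mulmx.
Qed.

Lemma haar_convolution (R : realType) (n : nat) (G D : set 'M[cplx R]_n)
    (muG mu : probability (borel 'M[cplx R]_n) R)
    (A : set (borel 'M[cplx R]_n)) :
  closed_unitary_subgroup G -> haar_probability G muG ->
  D `<=` G -> closed D -> mu D = 1%E -> measurable A ->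
  (\int[muG]_m mu [set h | A (m *m h)] = muG A)%E.
Proof.
move=> Ggr Ghaar DG Dc muD mA.
have mS := mulmx_preimage_measurable mA.
transitivity ((muG \x mu) [set x | A (x.1 *m x.2)])%E.
  by apply: eq_integral => m _; rewrite -xsection_mulmx.
(* Uniqueness of the product measure serves as Tonelli's theorem: [\x^] integrates in the other
   order. For [h] in [D] the inner mass is then [muG A] by right invariance, and the complement of
   [D] is null. *)
rewrite (@product_measure_unique _ _ _ _ _ muG mu (muG \x^ mu)%E)//; last first.
  by move=> B C mB mC; exact: product_measure2E.
transitivity (\int[mu]_(h in setT) muG A)%E.
  apply: ge0_ae_eq_integral => //.
  - exact: measurable_fun_ysection.
  - exists (~` D); split.
    + by apply: measurableC; exact: closed_borel.
    + by apply: probability_setC0 => //; exact: closed_borel.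
    + move=> h /= neq Dh; apply: neq => _ /=.
      by rewrite ysection_mulmx; exact: (haar_preimage_mul Ggr Ghaar (DG _ Dh) mA).2.
by rewrite integral_cst// -[RHS]mule1; congr (_ * _)%E; exact: probability_setT.
Qed.

(** Here [m' = m k] with [k] in the stabilizer, so the two sets differ by a left translation by
    [k]. *)
Lemma stabilizer_section_eq (R : realType) (n : nat) (G : set 'M[cplx R]_n)
    (v : 'cV[cplx R]_n) (mu : probability (borel 'M[cplx R]_n) R)
    (A : set (borel 'M[cplx R]_n)) (m m' : 'M[cplx R]_n) :
  closed_unitary_subgroup G -> haar_probability (stabilizer G v) mu ->
  measurable A -> G m -> G m' -> m *m v = m' *m v ->
  mu [set h | A (m *m h)] = mu [set h | A (m' *m h)].
Proof.
move=> Ggr Hhaar mA Gm Gm' mv; have [Gu _ GM GV _] := Ggr.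
have mU : m \in unitmx by apply: unitarymx_unit; exact: Gu.
have Hk : stabilizer G v (invmx m *m m').
  split; first by apply: GM => //; exact: GV.
  by rewrite -mulmxA -mv mulKmx.
have mAm : measurable ([set h | A (m *m h)] : set (borel 'M[cplx R]_n)).
  exact: continuous_borel_preimage (@mulmxl_continuous _ _ _ _ m) mA.
have [<- _] :=
  haar_preimage_mul (stabilizer_closed_unitary_subgroup v Ggr) Hhaar Hk mAm.
by congr (mu _); apply/seteqP; split=> h /=; rewrite !mulmxA mulmxV// mul1mx.
Qed.

Lemma section_superlevel_eq (R : realType) (n : nat) (G : set 'M[cplx R]_n)
    (v : 'cV[cplx R]_n) (mu nu1 nu2 : probability (borel 'M[cplx R]_n) R)
    (C : set 'M[cplx R]_n) (t : \bar R) :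
  closed_unitary_subgroup G -> haar_probability (stabilizer G v) mu ->
  nu1 G = 1%E -> nu2 G = 1%E ->
  (forall B : set (borel 'cV[cplx R]_n), measurable B ->
     nu1 [set g | B (g *m v)] = nu2 [set g | B (g *m v)]) ->
  closed C ->
  (nu1 [set m | t <= mu [set h | C (m *m h)]] =
   nu2 [set m | t <= mu [set h | C (m *m h)]])%E.
Proof.
move=> Ggr Hhaar nu1G nu2G nu12 Cc; have [Gu _ _ _ Gc] := Ggr.
have [Hu _ _ _ Hc] := stabilizer_closed_unitary_subgroup v Ggr.
have mC := closed_borel Cc; have mG := closed_borel Gc.
pose L : set (borel 'M[cplx R]_n) := [set m | t <= mu [set h | C (m *m h)]]%E.
pose K : set 'M[cplx R]_n := [set m | G m /\ (t <= mu [set h | C (m *m h)])%E].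
pose f (g : 'M[cplx R]_n) := g *m v.
have mL : measurable L.
  rewrite (_ : L = setT `&` (fun m => mu [set h | C (m *m h)]) @^-1` `[t, +oo[%classic).
    by apply: (mul_section_measurable mu mC) => //; exact: emeasurable_itv.
  by rewrite setTI; apply/seteqP; split=> m; rewrite /L /= in_itv /= andbT.
have Kc : closed K by exact: closed_superlevel_section Gc Hc Hu Hhaar.1 Cc.
have Kcompact : compact K by apply: unitary_closed_compact Kc => g [/Gu].
(* A continuous image of a closed set need not be closed; compactness of [K] makes this one closed,
   hence Borel. *)
have fKc : closed (f @` K).
  apply: compact_closed; first exact: norm_hausdorff.
  apply: continuous_compact => //; apply: continuous_subspaceT.
  exact: mulmxr_continuous.
have mf (B : set 'cV[cplx R]_n) : measurable (B : set (borel _)) ->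
    measurable ([set g | B (f g)] : set (borel 'M[cplx R]_n)).
  exact: continuous_borel_preimage (@mulmxr_continuous _ _ _ _ v).
(* A point of [G] with the same image as a point of [K] has the same section mass, so within [G] the
   set [L] is the preimage of the image of [K]. *)
have KE : L `&` G = [set g | (f @` K) (f g)] `&` G.
  apply/seteqP; split=> [g [Lg Gg]|g [[m [Gm tm] mg] Gg]]; split=> //.
    by exists g.
  by rewrite /L /= (stabilizer_section_eq Ggr Hhaar mC Gg Gm).
have mfK := mf _ (closed_borel fKc).
rewrite -/L -(probability_setI1 mG mL nu1G) -(probability_setI1 mG mL nu2G) KE.
rewrite (probability_setI1 mG mfK nu1G) (probability_setI1 mG mfK nu2G).
exact: nu12 (closed_borel fKc).
Qed.

Theorem theorem1p1 (R : realType) (N : nat) (N_gt0 : (0 < N)%N)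
    (G : set 'M[cplx R]_N) (e : 'I_N -> 'cV[cplx R]_N)
    (muG muH : probability (borel 'M[cplx R]_N) R)
    (d : measure_display) (T : measurableType d) (P : probability T R)
    (M H : {RV P >-> borel 'M[cplx R]_N}) :
  let e1 := e (Ordinal N_gt0) in
  let Hs := stabilizer G e1 in
  let f := fun g : borel 'M[cplx R]_N => (g *m e1 : borel 'cV[cplx R]_N) in
  closed_unitary_subgroup G ->
  orthonormal_basis e ->
  haar_probability G muG ->
  haar_probability Hs muH ->
  independent_rv P M H ->
  (forall w, G (M w)) ->
  (forall w, Hs (H w)) ->
  has_law P H muH ->
  has_law P (fun w => (M w *m H w : borel 'M[cplx R]_N)) muG <->
  has_law P (fun w => f (M w)) (pushforward muG f).
Proof.
move=> e1 Hs f Ggr _ Ghaar Hhaar indep GM HsH [_ HlawH].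
have [_ _ _ _ Hc] := stabilizer_closed_unitary_subgroup e1 Ggr.
have mf : measurable_fun setT f.
  exact: continuous_borel (@mulmxr_continuous _ _ _ _ e1).
have mfM : measurable_fun setT (fun w => f (M w)) by exact: measurableT_comp.
have mMH : measurable_fun setT (fun w => M w *m H w : borel 'M[cplx R]_N).
  apply: (@measurableT_comp _ _ _ _ _ _ _ _ (fun w => (M w, H w))
    (mulmx_borel_measurable (R := R) (m := N) (n := N) (p := N))).
  exact/measurable_fun_pair.
split=> [[_ MHlaw]|[_ Mlaw]]; split=> // A mA.
  rewrite /pushforward -MHlaw; last by rewrite -[X in measurable X]setTI; exact: mf.
  (* [H] fixes [e1], so [M H] and [M] send [e1] to the same vector for every outcome. *)
  congr (P _); apply/funext => w.
  by rewrite /preimage /= /f -mulmxA (HsH w).2.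
pose MH : {mfun T >-> borel 'M[cplx R]_N} :=
  HB.pack (fun w => M w *m H w : borel 'M[cplx R]_N)
    (isMeasurableFun.Build _ _ _ _ _ mMH).
rewrite -[LHS]/(distribution P MH A).
apply: probability_eq_on_closed A mA => C Cc.
have mC := closed_borel Cc.
(* Right invariance turns [muG C] into the [muG]-average of the mass of the sections of [C]. *)
rewrite -(haar_convolution Ggr Ghaar (fun h => @proj1 _ _) Hc Hhaar.1 mC).
have MG : distribution P M G = 1%E.
  rewrite -(probability_setT P); congr (P _).
  by apply/seteqP; split=> w //= _; exact: GM.
(* Equal masses of superlevel sets let the law of [M] replace [muG] in this average; independence
   identifies the result with the law of [M H] on [C]. *)
rewrite -(@ge0_integral_eq_superlevel _ _ _ (distribution P M) muG
  (fun m => muH [set h | C (m *m h)])).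
- have mS := mulmx_preimage_measurable mC.
  rewrite [LHS](independent_pair_law indep mS); apply: eq_integral => m _.
  by rewrite HlawH -?xsection_mulmx//; exact: measurable_xsection.
- exact: mul_section_measurable.
- by [].
move=> t; apply: (section_superlevel_eq t Ggr Hhaar MG Ghaar.1) => // B mB.
Qed.
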